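(* Let $E$ be an Archimedean effect algebra fulfilling the condition (W+). Then every meager element of $E$ is the orthosum of a system of hypermeager elements of $E$.
   Context: An effect algebra is a partial algebra $(E;\oplus,0,1)$ with $0\neq 1$ and a partial binary operation $\oplus$ such that for all $x,y,z\in E$: (1) $x\oplus y=y\oplus x$ if $x\oplus y$ is defined; (2) $(x\oplus y)\oplus z=x\oplus(y\oplus z)$ if one side is defined; (3) for every $x$ there is a unique $y$ (denoted $x'$) with $x\oplus y=1$; (4) if $1\oplus x$ is defined then $x=0$. One writes $x\le y$ and $y\ominus x=z$ iff $x\oplus z$ is defined and equals $y$; $\le$ is a partial order. $E$ is Archimedean if for every nonzero $x\in E$ there is a greatest positive integer $n$ such that $nx=x\oplus\dots\oplus x$ ($n$ times) exists. A system $G=(x_\kappa)_{\kappa\in H}$ of not necessarily different elements of $E$ is orthogonal if for every finite subsystem $K$ of $G$ the sum $\bigoplus K$ exists (with $\bigoplus\emptyset=0$). Put $G^\oplus=\{\bigoplus K\mid K\subseteq G\text{ finite}\}$. The orthosum $\bigoplus G$ of an orthogonal system $G$ exists iff the supremum $\bigvee G^\oplus$ exists in $E$, and then $\bigoplus G=\bigvee G^\oplus$. $E$ fulfills the condition (W+) if for each orthogonal subset $A\subseteq E$ and each two upper bounds $u,v$ of $A^\oplus$ there exists an upper bound $w$ of $A^\oplus$ with $w\le u$ and $w\le v$. An element $x\in E$ is sharp if $x\wedge x'=0$; $\mathrm{S}(E)$ is the set of sharp elements. An element $x\in E$ is meager if $v\in\mathrm{S}(E)$ and $v\le x$ imply $v=0$.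 An element $x\in E$ is hypermeager if there is $y\in E$ with $x\le y$ and $x\le y'$. *)

(* Defs.v *)
From HB Require Import structures.
From mathcomp Require Import all_boot finmap.
From mathcomp Require Import boolp classical_sets.

Set Implicit Arguments.
Unset Strict Implicit.
Unset Printing Implicit Defensive.

Local Open Scope classical_set_scope.

(* The partial operation is [oplus : E -> E -> option E], where [None] means
   "undefined".  Commutativity and associativity are equalities in [option E]:
   if one side is defined, then so is the other, with the same value. *)
HB.mixin Record isEffectAlgebra (E : Type) := {
  oplus : E -> E -> option E;
  ezero : E;
  eone : E;
  ezero_neq_eone : ezero <> eone;
  oplusC : forall x y, oplus x y = oplus y x;
  oplusA : forall x y z,
    obind (fun s => oplus s z) (oplus x y) = obind (oplus x) (oplus y z);
  oplus_supp : forall x, exists! y, oplus x y = Some eone;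
  oplus_eone : forall x, oplus eone x <> None -> x = ezero
}.

#[short(type="effectAlgType")]
HB.structure Definition EffectAlgebra := {E of isEffectAlgebra E}.

Section EffectAlgebraDefs.
Variable E : effectAlgType.
Implicit Types x y z u v w : E.

Definition esupp x : E := sval (cid (oplus_supp x)).

Definition ele x y : Prop := exists z, oplus x z = Some y.

Definition is_meet x y m : Prop :=
  [/\ ele m x, ele m y & forall z, ele z x -> ele z y -> ele z m].

Definition upper_bound (S : set E) u : Prop := forall s, S s -> ele s u.

Definition is_join (S : set E) u : Prop :=
  upper_bound S u /\ forall v, upper_bound S v -> ele u v.

Definition oadd (a b : option E) : option E :=
  if a is Some x then if b is Some y then oplus x y else None else None.

Definition nmul (n : nat) x : option E :=
  \big[oadd/Some ezero]_(i < n) Some x.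

Definition archimedean : Prop :=
  forall x, x <> ezero ->
    exists n, [/\ 0 < n, nmul n x <> None &
      forall m, 0 < m -> nmul m x <> None -> m <= n].

Definition fin_oplus (H : Type) (G : H -> E) (K : {fset {classic H}}) :
    option E :=
  \big[oadd/Some ezero]_(i <- K) Some (G i).

Definition orthogonal (H : Type) (G : H -> E) : Prop :=
  forall K : {fset {classic H}}, fin_oplus G K <> None.

Definition oplus_closure (H : Type) (G : H -> E) : set E :=
  [set s | exists K : {fset {classic H}}, fin_oplus G K = Some s].

Definition is_orthosum (H : Type) (G : H -> E) x : Prop :=
  orthogonal G /\ is_join (oplus_closure G) x.

(* A subset [A] is regarded as the system of its elements, each occurring
   exactly once: the inclusion [val] of the subtype [A] into [E]. *)
Definition subset_system (A : set E) : A -> E := val.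

Definition condition_Wplus : Prop :=
  forall A : set E, orthogonal (@subset_system A) ->
  forall u v, upper_bound (oplus_closure (@subset_system A)) u ->
    upper_bound (oplus_closure (@subset_system A)) v ->
  exists w, [/\ upper_bound (oplus_closure (@subset_system A)) w,
    ele w u & ele w v].

Definition sharp x : Prop := is_meet x (esupp x) ezero.

Definition meager x : Prop := forall v, sharp v -> ele v x -> v = ezero.

Definition hypermeager x : Prop := exists y, ele x y /\ ele x (esupp y).

Lemma esuppP x y : oplus x y = Some eone <-> y = esupp x.
Proof.
rewrite /esupp; case: cid => z [/= xz uz].
by split=> [/uz//|->].
Qed.

Lemma oplusx0 x : oplus x ezero = Some x.
Proof.
have e10 : oplus (eone : E) ezero = Some eone.
  have h : oplus (eone : E) (esupp eone) = Some eone by apply/esuppP.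
  by have /oplus_eone e : oplus (eone : E) (esupp eone) <> None;
    [rewrite h | rewrite e in h].
have hx : oplus x (esupp x) = Some eone by apply/esuppP.
have hx' : oplus (esupp x) x = Some eone by rewrite oplusC.
have := oplusA (esupp x) x ezero.
rewrite hx' /= e10; case e : (oplus x ezero) => [s|]//= /esym hs.
by move/esuppP: hs => ->; move/esuppP: hx' => {2}->.
Qed.

Lemma oaddA : associative oadd.
Proof.
move=> [x|] [y|] [z|] //=; last by case: oplus.
by have := oplusA x y z; case: (oplus x y) => [s|]; case: (oplus y z).
Qed.

Lemma oaddC : commutative oadd.
Proof. by move=> [x|] [y|] //=; exact: oplusC. Qed.

Lemma oadd0x : left_id (Some ezero) oadd.
Proof. by move=> [x|] //=; rewrite oplusC oplusx0. Qed.

(* Finite sums do not depend on the enumeration of the index set. *)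
HB.instance Definition _ :=
  Monoid.isComLaw.Build (option E) (Some ezero) oadd oaddA oaddC oadd0x.

End EffectAlgebraDefs.

Arguments archimedean E : clear implicits.
Arguments condition_Wplus E : clear implicits.

(* Main.v *)
(* Condition (W+) concerns sets, whereas the desired system may need repeated
   elements.  So take a set A of nonzero finite sums of hypermeager elements,
   maximal among the orthogonal ones whose finite sums lie below x, and then a
   finite sum j of hypermeager elements that fits on top of A below x and
   cannot be enlarged.  The system consists of the summands of all members of
   A and of j.  If v bounds its finite sums, (W+) gives a bound w of the finite
   sums of A below v - j and x - j.  If z = x - j - w were nonzero, it would not
   be sharp, as x is meager, so some nonzero h would satisfy h <= z and h <= z';
   this h is hypermeager and j + h contradicts the choice of j.  Hence
   x = j + w <= v. *)

From mathcomp Require Import all_boot finmap.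
From mathcomp Require Import boolp classical_sets.
Require Import Defs.

Set Implicit Arguments.
Unset Strict Implicit.
Unset Printing Implicit Defensive.

Local Open Scope classical_set_scope.

Section EffectAlgebraTheory.
Variable E : effectAlgType.
Implicit Types (x y z u v w h j : E) (a b c : option E) (A : set E).

(** * Order and cancellation for partial sums *)

Definition osum (s : seq E) : option E :=
  \big[@oadd E/Some ezero]_(y <- s) Some y.

(* [ole a (Some x)] says that [a] is defined and at most [x]. *)
Definition ole a b : Prop := exists c, oadd a c = b.

Lemma oaddx0 a : oadd a (Some ezero) = a.
Proof. by rewrite oaddC oadd0x. Qed.

Lemma oadd_eq_Some a b t : oadd a b = Some t ->
  exists x y, a = Some x /\ b = Some y.
Proof. by case: a => [x|]//; case: b => [y|]// _; exists x, y. Qed.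

Lemma ole_Some a t : ole a (Some t) -> exists x, a = Some x.
Proof. by case=> c /oadd_eq_Some[x [y [-> _]]]; exists x. Qed.

Lemma eleE x y : ele x y <-> ole (Some x) (Some y).
Proof.
split=> [[z xz]|[c]]; first by exists (Some z).
by case: c => // z xz; exists z.
Qed.

Lemma ole_addr a b : ole a (oadd a b).
Proof. by exists b. Qed.

Lemma ole_refl a : ole a a.
Proof. by exists (Some ezero); exact: oaddx0. Qed.

Lemma ole_trans b a c : ole a b -> ole b c -> ole a c.
Proof. by move=> [d <-] [e <-]; exists (oadd d e); rewrite oaddA. Qed.

Lemma ole_add2l c a b : ole a b -> ole (oadd c a) (oadd c b).
Proof. by move=> [d <-]; exists d; rewrite oaddA. Qed.

(** Adding the supplement of [t] turns both sums into 1, so [b] and [c] are both the unique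
    supplement of the same element. *)
Lemma oadd_cancel x b c t :
  oadd (Some x) b = Some t -> oadd (Some x) c = Some t -> b = c.
Proof.
have compl d : oadd (Some x) d = Some t ->
    oadd (oadd (Some (esupp t)) (Some x)) d = Some eone.
  by move=> e; rewrite -oaddA e oaddC; apply/esuppP.
move=> /compl + /compl; case: (oadd (Some (esupp t)) _) => [q|]//.
by case: b => [y|]//; case: c => [z|]//= /esuppP-> /esuppP->.
Qed.

(** Since 1 = 1 + (x + b) = (1 + x) + b, the sum 1 + x is defined, which forces x = 0. *)
Lemma oadd_eq0 x b : oadd (Some x) b = Some ezero -> x = ezero.
Proof.
move=> xb; apply: oplus_eone => one_x.
have : oadd (oadd (Some eone) (Some x)) b = Some eone.
  by rewrite -oaddA xb oaddx0.
by rewrite [oadd (Some _) (Some x)]one_x.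
Qed.

Lemma oadd_idl x c : oadd (Some x) c = Some x -> c = Some ezero.
Proof. by move=> xc; apply: oadd_cancel xc _; rewrite oaddx0. Qed.

Lemma ole_cancel x b u t :
  oadd (Some x) (Some u) = Some t -> ole (oadd (Some x) b) (Some t) ->
  ole b (Some u).
Proof. by move=> xu [c xbc]; exists c; apply: oadd_cancel xu; rewrite oaddA. Qed.

Lemma ele0x x : ele ezero x.
Proof. by apply/eleE; exists (Some x); rewrite oadd0x. Qed.

Lemma hypermeager0 : hypermeager (ezero : E).
Proof. by exists ezero; split; exact: ele0x. Qed.

Lemma meager_hypermeager x z : meager x -> ele z x -> z <> ezero ->
  exists h, [/\ hypermeager h, h <> ezero & ele h z].
Proof.
move=> xm zx z0; apply: contrapT => noh; apply/z0/xm => //.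
split; [exact: ele0x|exact: ele0x|move=> h hz hz'].
have [->|h0] := pselect (h = ezero); first exact: ele0x.
by case: noh; exists h; split=> //; exists z.
Qed.

(** Being duplicate-free, [s] is a permutation of a subsequence of [t]; the remaining entries of [t]
    provide the difference. *)
Lemma ole_big_uniq (I : eqType) (F : I -> option E) (s t : seq I) :
  uniq s -> {subset s <= t} ->
  ole (\big[@oadd E/Some ezero]_(i <- s) F i)
      (\big[@oadd E/Some ezero]_(i <- t) F i).
Proof.
move=> us st.
have /count_subseqP[s' s't ss'] : forall i, count_mem i s <= count_mem i t.
  move=> i; rewrite count_uniq_mem//; case: (boolP (i \in s)) => // /st.
  by rewrite -has_pred1 has_count.
have [r ts'] := perm_to_subseq s't.
by rewrite (perm_big _ ss') (perm_big _ ts') big_cat; exact: ole_addr.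
Qed.

Lemma fin_oplus_seq (H : Type) (G : H -> E) (s : seq {classic H}) : uniq s ->
  exists K : {fset {classic H}},
    fin_oplus G K = \big[@oadd E/Some ezero]_(i <- s) Some (G i).
Proof.
move=> us; exists [fset i in s]%fset; apply: perm_big.
by apply: uniq_perm => // i; rewrite in_fset.
Qed.

Lemma nmul_ole_osum h (s : seq {classic E}) :
  (forall y : {classic E}, y \in s -> ele h y) ->
  ole (nmul (size s) h) (osum s).
Proof.
rewrite /osum/nmul; elim: s => [|y s IHs] hs /=.
  by rewrite big_ord0 big_nil; exact: ole_refl.
rewrite big_ord_recl big_cons.
have /eleE [c <-] : ele h y by apply: hs; exact: mem_head.
rewrite -oaddA; apply: ole_add2l; apply: ole_trans (IHs _) _.
  by move=> z zs; apply: hs; rewrite inE zs orbT.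
by exists c; rewrite oaddC.
Qed.

(** * Maximal systems of sums of hypermeager elements *)

(* Orthogonality is expressed with duplicate-free lists rather than [{fset A}],
   so that sums over different sets [A] live in one type. *)
Definition fits x (A : set E) c : Prop :=
  forall s : seq {classic E}, uniq s ->
  (forall y : {classic E}, y \in s -> A y) ->
  ole (oadd c (osum s)) (Some x).

(** Letting [k] exceed the length is harmless, as the default 0 is hypermeager; it later allows
    infinite rows of summands. *)
Definition hypersum y : Prop :=
  exists s : seq E, (forall k, hypermeager (nth ezero s k)) /\
    osum s = Some y.

Lemma hypersum0 : hypersum (ezero : E).
Proof.
exists [::]; split; last by rewrite /osum big_nil.
by move=> k; rewrite nth_nil; exact: hypermeager0.
Qed.

Lemma hypersumD h j t : hypermeager h -> hypersum j ->
  oadd (Some h) (Some j) = Some t -> hypersum t.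
Proof.
move=> hh [s [hs sj]] ht; exists (h :: s); split.
  by case=> [|k] /=; [|exact: hs].
by rewrite /osum big_cons [X in oadd _ X]sj.
Qed.

Lemma fits_setU1 x A y :
  fits x A (Some y) -> fits x (A `|` [set y]) (Some ezero).
Proof.
move=> fA s us sA; rewrite oadd0x.
pose s' := rem (y : {classic E}) s.
have s'A (z : {classic E}) : z \in s' -> A z.
  by rewrite mem_rem_uniq// inE => /andP[/eqP zy /sA[]].
have := fA s' (rem_uniq _ us) s'A.
case: (boolP ((y : {classic E}) \in s)) => ys.
  by rewrite /osum (perm_big _ (perm_to_rem ys)) big_cons.
by rewrite /s' rem_id//; apply: ole_trans; rewrite oaddC; exact: ole_addr.
Qed.

Definition hypersystem x (A : set E) : Prop :=
  (forall y, A y -> y <> ezero /\ hypersum y) /\ fits x A (Some ezero).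

Lemma maximal_hypersystem x : exists A, hypersystem x A /\
  forall y, y <> ezero -> hypersum y -> fits x A (Some y) -> A y.
Proof.
have [|A [[Ah fA] maxA]] := @Zorn_bigcup E (hypersystem x).
  move=> F Fh totF; split=> [y [X FX Xy]|s us sF]; first exact: (Fh X FX).1.
  (* A finite list from the union of a chain lies in one member; the empty list is separate because
     the chain may be empty. *)
  have [->|[X FX sX]] : s = [::] \/
      exists2 X, F X & forall y : {classic E}, y \in s -> X y.
    elim: s {us} sF => [|y s IHs] sF; [by left|right].
    have [|X FX Xy] := sF y; first by exact: mem_head.
    have [z zs|s0|[Z FZ sZ]] := IHs.
    - by apply: sF; rewrite inE zs orbT.
    - by exists X => // z; rewrite s0 inE => /eqP->.
    have [XZ|ZX] := totF _ _ FX FZ.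
      by exists Z => // z; rewrite inE => /orP[/eqP->|/sZ//]; exact: XZ.
    by exists X => // z; rewrite inE => /orP[/eqP->//|/sZ]; exact: ZX.
  - rewrite oadd0x /osum big_nil; apply/eleE; exact: ele0x.
  exact: (Fh X FX).2.
exists A; split=> // y y0 hy fy; apply: contrapT => Ay.
apply: (maxA (A `|` [set y])).
  by split=> [z Az|BA]; [left|apply/Ay/BA; right].
split; last exact: fits_setU1.
by move=> z [/Ah//|->].
Qed.

(* Suppose that there is no such [j].  Then hypermeager elements can be added
   forever, starting from 0; the partial sums are distinct, lie in [A] by
   [maxA], and dominate the first one, [h].  As [A] is orthogonal, every
   multiple of [h] exists, against the Archimedean property. *)
Lemma maximal_summand x A : archimedean E -> hypersystem x A ->
  (forall y, y <> ezero -> hypersum y -> fits x A (Some y) -> A y) ->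
  exists j, [/\ hypersum j, fits x A (Some j) &
    forall h, hypermeager h -> h <> ezero ->
      ~ fits x A (oadd (Some h) (Some j))].
Proof.
move=> arch [Ah fA] maxA; apply: contrapT => nomax.
have step j : hypersum j -> fits x A (Some j) -> exists h j',
    [/\ h <> ezero, hypersum j', fits x A (Some j') &
        oadd (Some h) (Some j) = Some j'].
  move=> hj fj; apply: contrapT => nostep; apply: nomax; exists j; split=> //.
  move=> h hh h0 fhj; apply: nostep.
  have [j' hj'] : exists j', oadd (Some h) (Some j) = Some j'.
    apply: (@ole_Some _ x).
    by have := fhj [::] isT; rewrite /osum big_nil oaddx0; apply.
  exists h, j'; split=> //; last by rewrite -hj'.
  exact: hypersumD hj'.
have [h [h1 [h0 hh1 fh1 eh1]]] := step _ hypersum0 fA.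
rewrite oaddx0 in eh1; case: eh1 => eh1; rewrite -{h1}eh1 in hh1 fh1.
(* The list [s] holds the earlier sums. Each differs from the current [j] by a nonzero [d], so [j]
   is not in [s] and can be put in front of it. *)
have chain n : exists j (s : seq {classic E}),
    [/\ hypersum j, fits x A (Some j) & ele h j] /\
    [/\ size s = n, uniq s & forall y : {classic E}, y \in s ->
      [/\ A y, ele h y & exists2 d, d <> ezero & oplus y d = Some j]].
  elim: n => [|n [j [s [[hj fj /eleE hlej] [sn us sP]]]]].
    by exists h, [::]; split; split=> //; apply/eleE/ole_refl.
  have j0 : j <> ezero.
    by move=> j0; case: hlej => c; rewrite j0 => /oadd_eq0.
  have [d [j' [d0 hj' fj' dj]]] := step j hj fj.
  exists j', (@cons {classic E} j s); split; split=> //.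
  - by apply/eleE/(ole_trans hlej); exists (Some d); rewrite oaddC.
  - by rewrite /= sn.
  - rewrite /= us andbT; apply/negP => /sP[_ _ [e e0 je]].
    apply: e0; apply: Some_inj.
    exact: (@oadd_idl j).
  move=> y; rewrite inE => /orP[/eqP->|/sP[Ay hy [e e0 ye]]].
    split; [exact: maxA|exact/eleE|exists d => //].
    by rewrite oplusC.
  split=> //.
  have : oadd (Some y) (oadd (Some e) (Some d)) = Some j'.
    rewrite oaddA [oadd (Some y) _]ye -dj; exact: oaddC.
  case ed : (oadd (Some e) (Some d)) => [f|]// yf; exists f => //.
  by move=> f0; apply: e0; apply: oadd_eq0 (Some d) _; rewrite ed f0.
have [n [_ _ nmax]] := arch h h0.
have [j [s [_ [sn us sP]]]] := chain n.+1.
have sumx : ole (osum s) (Some x).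
  rewrite -[osum s]oadd0x; apply: fA => // y; by case/sP.
have : ole (nmul n.+1 h) (Some x).
  by rewrite -sn; apply: ole_trans sumx; apply: nmul_ole_osum => y /sP[].
case/ole_Some => q nq; suff : n < n by rewrite ltnn.
by apply: nmax => //; rewrite nq.
Qed.

(** * From duplicate-free lists to systems and back *)

Definition set_vals (A : set E) (s : seq {classic A}) : seq {classic E} :=
  @map {classic A} {classic E} (fun a : A => val a) s.

Lemma set_vals_uniq A (s : seq {classic A}) : uniq s -> uniq (set_vals s).
Proof. by rewrite map_inj_uniq// => ? ?; exact: val_inj. Qed.

Lemma set_vals_in A (s : seq {classic A}) (y : {classic E}) :
  y \in set_vals s -> A y.
Proof. by move=> /mapP[a _ ->]; apply: set_mem; exact: valP. Qed.

Lemma osum_set_vals A (s : seq {classic A}) :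
  osum (set_vals s) =
  \big[@oadd E/Some ezero]_(a <- s) Some (subset_system (a : A)).
Proof. by rewrite /osum big_map. Qed.

Lemma fits_orthogonal x A j : fits x A (Some j) ->
  orthogonal (@subset_system E A).
Proof.
move=> fA K KN.
have := fA (set_vals K) (set_vals_uniq (fset_uniq K)) (@set_vals_in A K).
by rewrite osum_set_vals [X in oadd _ X]KN => -[].
Qed.

(** Brings a bound supplied by (W+) back to lists, by lifting the entries of [s] to the subtype of
    [A]. *)
Lemma upper_bound_osum A w : orthogonal (@subset_system E A) ->
  upper_bound (oplus_closure (@subset_system E A)) w ->
  forall s : seq {classic E}, uniq s ->
  (forall y : {classic E}, y \in s -> A y) ->
  ole (osum s) (Some w).
Proof.
move=> oA Aw s us sA.
have [t ts] : exists t : seq {classic A}, set_vals t = s.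
  elim: s sA {us} => [|y s IHs] sA; first by exists [::].
  have [|t ts] := IHs; first by move=> z zs; apply: sA; rewrite inE zs orbT.
  have Ay : A y by apply: sA; exact: mem_head.
  by exists (@cons {classic A} (SigSub (mem_set Ay)) t); rewrite -ts.
have ut : uniq t by move: us; rewrite -ts; exact: map_uniq.
have [K Kt] := fin_oplus_seq (@subset_system E A) ut.
have -> : osum s = fin_oplus (@subset_system E A) K.
  by rewrite Kt -ts osum_set_vals.
case y_def : (fin_oplus (@subset_system E A) K) => [y|]; last by have := oA K.
by apply/eleE/Aw; exists K.
Qed.

Lemma big_nth_iota (s : seq E) n : size s <= n ->
  \big[@oadd E/Some ezero]_(k <- iota 0 n) Some (nth ezero s k) = osum s.
Proof.
move=> /subnKC <-; rewrite iotaD big_cat /= [X in oadd _ X]big1_seq.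
  by rewrite oaddx0 -[in RHS](mkseq_nth ezero s) /osum /mkseq big_map.
move=> k; rewrite mem_iota add0n => /andP[_ /andP[sk _]].
by rewrite nth_default.
Qed.

End EffectAlgebraTheory.

Theorem proposition3p4 (E : effectAlgType) (E_archimedean : archimedean E)
    (E_Wplus : condition_Wplus E) (x : E) (x_meager : meager x) :
  exists (H : Type) (G : H -> E),
    (forall k : H, hypermeager (G k)) /\ is_orthosum G x.
Proof.
have [A [sysA maxA]] := maximal_hypersystem x.
have [j [hj fj maxj]] := maximal_summand E_archimedean sysA maxA.
have /choice[f fP] : forall o : option A, exists s : seq E,
    (forall k, hypermeager (nth ezero s k)) /\
    osum s = Some (oapp (fun a : A => val a) j o).
  by case=> [a|]//=; have [_] := sysA.1 _ (set_mem (valP a)).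
(* Row [None] lists the summands of [j], row [Some a] those of [a]; beyond its
   length each row is padded with 0, which is hypermeager. *)
pose G (p : option A * nat) := nth ezero (f p.1) p.2.
(* Every finite index set lies in such a rectangle, and once [n] reaches all row lengths the sum
   over it is [j] plus the sum of [F]. *)
pose rect (F : seq {classic A}) n : seq {classic (option A * nat)%type} :=
  [seq (o, k) | o <- None :: map Some F, k <- iota 0 n].
have uniq_rect F n : uniq F -> uniq (rect F n).
  move=> uF; apply: (@allpairs_uniq {classic (option A)} nat).
  - rewrite /= map_inj_uniq ?uF ?andbT; last by move=> ? ? [].
    by apply/mapP => -[].
  - exact: iota_uniq.
  - by move=> [? ?] [? ?] _ _ [-> ->].
pose sizes (F : seq {classic A}) :=
  \max_(o <- None :: map Some F) size (f o).
have big_rect F n : sizes F <= n ->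
    \big[@oadd E/Some ezero]_(p <- rect F n) Some (G p) =
    oadd (Some j) (osum (set_vals F)).
  move=> Fn; rewrite /rect big_allpairs.
  transitivity (\big[@oadd E/Some ezero]_(o <- None :: map Some F) osum (f o)).
    apply: (@eq_big_seq _ _ _ {classic (option A)}) => o oF.
    apply: (@big_nth_iota _ (f o)); apply: leq_trans Fn.
    exact: (@leq_bigmax_seq {classic (option A)}).
  rewrite big_cons (fP None).2 osum_set_vals big_map; congr (oadd _ _).
  by apply: eq_bigr => a _; rewrite (fP (Some a)).2.
have fit_map (F : seq {classic A}) : uniq F ->
    ole (oadd (Some j) (osum (set_vals F))) (Some x).
  by move=> uF; apply: fj; [exact: set_vals_uniq|exact: set_vals_in].
have Gx (K : {fset {classic (option A * nat)%type}}) :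
    ole (fin_oplus G K) (Some x).
  pose F : seq {classic A} :=
    undup (@pmap {classic (option A * nat)%type} {classic A} (fun p => p.1) K).
  (* The first bound makes the rows complete; the second, with a successor since columns stay below
     [n], makes the rectangle contain [K]. *)
  pose n := maxn (sizes F) (\max_(p <- K) p.2.+1).
  have := fit_map F (undup_uniq _); rewrite -(big_rect _ n) ?leq_maxl//.
  apply: ole_trans; apply: ole_big_uniq => [|[o k] pK].
    exact: fset_uniq.
  apply: (@allpairs_f {classic (option A)}).
    case: o pK => [a|] pK; last exact: mem_head.
    rewrite inE; apply/orP; right; apply: map_f; rewrite mem_undup.
    by rewrite mem_pmap; apply/mapP; exists (Some a, k).
  rewrite mem_iota leq0n add0n leq_max; apply/orP; right.
  exact: (@leq_bigmax_seq {classic (option A * nat)%type} (enum_fset K) xpredT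
    (fun p => p.2.+1) (o, k) pK isT).
exists (option A * nat)%type, G; split; first by move=> [o k]; exact: (fP o).1.
split; first by move=> K; have /ole_Some[y ->] := Gx K.
split=> [y [K Ky]|v Gv]; first by apply/eleE; rewrite -Ky.
have fitv (F : seq {classic A}) : uniq F ->
    ole (oadd (Some j) (osum (set_vals F))) (Some v).
  move=> uF; have [K KF] := fin_oplus_seq G (uniq_rect F (sizes F) uF).
  rewrite big_rect// in KF; rewrite -KF.
  have /ole_Some[y Ky] := Gx K.
  by rewrite Ky; apply/eleE/Gv; exists K.
(* Applied to [v] and to [x]: by cancellation, subtracting [j] leaves a bound of the finite sums of
   [A]. *)
have rest t : (forall F : seq {classic A}, uniq F ->
      ole (oadd (Some j) (osum (set_vals F))) (Some t)) ->
    exists2 u, oadd (Some j) (Some u) = Some t &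
      upper_bound (oplus_closure (@subset_system E A)) u.
  move=> fit; have [c jc] : ole (Some j) (Some t).
    by have := fit [::] isT; rewrite /osum big_nil oaddx0.
  case: c jc => // u ju; exists u => // y [K Ky]; apply/eleE.
  apply: ole_cancel ju _; rewrite -Ky.
  by have := fit _ (fset_uniq K); rewrite osum_set_vals.
have [u ju uA] := rest _ fitv; have [t jt tA] := rest _ fit_map.
have oA := fits_orthogonal fj.
have [w [wA /eleE[c wu] /eleE[d wt]]] := E_Wplus A oA _ _ uA tA.
case: d wt => // z wt.
have [z0|z0] := pselect (z = ezero).
  apply/eleE; rewrite -jt -ju -wt z0 oaddx0 -wu; apply: ole_add2l.
  exact: ole_addr.
have jwz : oadd (Some j) (oadd (Some w) (Some z)) = Some x by rewrite wt.
have zx : ele z x.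
  by apply/eleE; rewrite -jwz oaddA oaddC; exact: ole_addr.
have [h [hh h0 /eleE hz]] := meager_hypermeager x_meager zx z0.
(* Sums of [A] are below [w] and [h] is below [z], so adding [h] and [j] to such a sum stays below j
   + w + z = x. *)
case: (maxj h hh h0) => s us sA.
apply: ole_trans (ole_add2l _ (upper_bound_osum oA wA us sA)) _.
rewrite -jwz [oadd (Some h) _]oaddC -oaddA [oadd (Some h) _]oaddC.
exact/ole_add2l/ole_add2l.
Qed.
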